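(* Let $p$ be an odd prime and let $(f_u)$ be the binary sequence of period $p^2$ defined, for $u\ge 0$, by $f_u=0$ if $\left(\frac{q_p(u)}{p}\right)=1$ or $q_p(u)=0$, and $f_u=1$ otherwise, where $\left(\frac{\cdot}{p}\right)$ is the Legendre symbol. If $2^{p-1}\not\equiv 1\pmod{p^2}$, then the linear complexity of $(f_u)$ satisfies $$L((f_u))=\begin{cases}p^2-p, & \text{if } p\equiv 1\pmod 4,\\ p^2-1, & \text{if } p\equiv 3\pmod 4.\end{cases}$$
   Context: Fermat quotient: for an odd prime $p$ and an integer $u$ with $\gcd(u,p)=1$, $q_p(u)$ is the unique integer with $q_p(u)\equiv\frac{u^{p-1}-1}{p}\pmod p$ and $0\le q_p(u)\le p-1$; moreover $q_p(kp)=0$ for all $k\in\mathbb{Z}$. Linear complexity: for a (purely) periodic binary sequence $(s_u)_{u\ge 0}$ over $\mathbb{F}_2$, $L((s_u))$ is the least order $L$ of a linear recurrence relation over $\mathbb{F}_2$ $$s_{u+L}=c_{L-1}s_{u+L-1}+\cdots+c_1s_{u+1}+c_0s_u\quad\text{for all } u\ge 0$$ which is satisfied by $(s_u)$, where $c_0=1$ and $c_1,\ldots,c_{L-1}\in\mathbb{F}_2$. *)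

(* Defs.v *)
From mathcomp Require Import all_boot all_order all_algebra.

Set Implicit Arguments.
Unset Strict Implicit.
Unset Printing Implicit Defensive.

Import Order.TTheory GRing.Theory Num.Theory.
Local Open Scope ring_scope.

(* For p prime, the division by p below is exact when u is coprime to p (Fermat),
   and [%%] returns the representative in {0, ..., p - 1}. *)
Definition fermat_quotient (p : nat) (u : int) : int :=
  if coprimez u p%:Z then (((u ^+ p.-1 - 1) %/ p%:Z)%Z %% p%:Z)%Z else 0.

(* Only for p prime: otherwise 'F_p is the field whose order is the least prime
   divisor of p. *)
Definition legendre (a : int) (p : nat) : int :=
  if a%:~R == 0 :> 'F_p then 0
  else if [exists x : 'F_p, x ^+ 2 == a%:~R] then 1 else -1.

Definition fermat_quotient_seq (p : nat) (u : nat) : 'F_2 :=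
  let q := fermat_quotient p u%:Z in
  if (legendre q p == 1) || (q == 0) then 0 else 1.

(* Only c 0, ..., c (L - 1) occur in the recurrence; for L = 0 it says that s is
   the zero sequence. *)
Definition satisfies_recurrence (s : nat -> 'F_2) (L : nat) : Prop :=
  exists c : nat -> 'F_2,
    c 0%N = 1 /\ forall u : nat, s (u + L)%N = \sum_(i < L) c i * s (u + i)%N.

Definition is_linear_complexity (s : nat -> 'F_2) (L : nat) : Prop :=
  satisfies_recurrence s L /\
  forall M : nat, satisfies_recurrence s M -> (L <= M)%N.

(* Main.v *)
Require Import Defs.
From mathcomp Require Import all_boot all_order all_algebra.
From mathcomp Require Import all_solvable all_field ring zify.

(** Let s be the sequence, N = p^2, and put T(y) = sum_(u < N) s_u y^u for y in
   an extension of F_2 containing a primitive N-th root of unity z.  If C is the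
   characteristic polynomial of a recurrence satisfied by s, then
   C(y^-1) T(y) = 0 whenever y^N = 1, so the order of the recurrence is at least
   the number of i < N with T(z^i) <> 0.

   s_u says whether q_p(u) is a nonsquare mod p, and q_p(u + kp) = q_p(u) - k/u
   mod p.  Hence in a residue class v <> 0 mod p the p terms of s run once
   through the nonsquare indicator: their sum is (p - 1)/2, which settles T at
   the p-th roots of unity and gives the recurrences of the stated orders.

   Suppose that T(y) = 0 with y primitive, and let w = y^p.  By Frobenius T
   vanishes at y^(2^((p - 1)k)) = y w^(qk), where 2^(p - 1) = 1 + qp and p does
   not divide q.  So the polynomial sum_(v < p) a_v y^v X^v with
   a_v = sum_k s_(v + kp) w^k vanishes at all p-th roots of unity, whence
   a_v = 0 for all v.  But a_v is a power of w times the value at w^-v of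
   sum_(l nonsquare) X^l, a nonzero polynomial of degree less than p that also
   vanishes at 0, which would give it p roots. *)

Set Implicit Arguments.
Unset Strict Implicit.
Unset Printing Implicit Defensive.

Import GRing.Theory Num.Theory.
Local Open Scope ring_scope.

(** * Roots of unity and recurrences over F_2 *)

Lemma exists_primitive_root (F : finFieldType) (n : nat) :
  (0 < n)%N -> n%:R != 0 :> F ->
  exists (L : fieldExtType F) (z : L), n.-primitive_root z.
Proof.
move=> n_gt0 nF.
(* As n is invertible, X^n - 1 is separable, so its splitting field contains n distinct n-th roots
   of unity. *)
have /FinSplittingFieldFor[L [rs]]: ('X^n - 1 : {poly F}) != 0.
  by rewrite monic_neq0 ?monicXnsubC.
rewrite rmorphB /= rmorph1 map_polyXn => eq_rs _.
exists L; suffices /hasP[z _ zP] : has n.-primitive_root rs by exists z.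
apply: has_prim_root => //.
- by apply/allP=> x; rewrite -root_prod_XsubC -(eqp_root eq_rs).
- rewrite -separable_prod_XsubC -(eqp_separable eq_rs).
  apply: separable_Xn_sub_1.
  by rewrite -(rmorph_nat (in_alg L)) fmorph_eq0.
- by rewrite -ltnS -(size_prod_XsubC _ id) -(eqp_size eq_rs) size_XnsubC.
Qed.

Lemma sum_shift_period (V : zmodType) (N : nat) (g : nat -> V) (i : nat) :
  (forall u, g (u + N)%N = g u) ->
  \sum_(u < N) g (u + i)%N = \sum_(u < N) g u.
Proof.
move=> gN; elim: i => [|i IHi]; first by apply: eq_bigr => u _; rewrite addn0.
rewrite -IHi; case: N gN {IHi} => [|N] gN; first by rewrite !big_ord0.
rewrite big_ord_recr big_ord_recl /= addrC; congr (_ + _).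
  by rewrite -addSnnS addnC gN.
by apply: eq_bigr => u _; rewrite /= /bump add1n addSnnS.
Qed.

(** The discrete Fourier transform of one period, when [y] runs over the [N]-th roots of unity. *)
Definition spectrum (L : fieldExtType 'F_2) (s : nat -> 'F_2) (N : nat) (y : L)
  : L := \sum_(u < N) (s u)%:A * y ^+ u.

Lemma pchar_F2ext (L : fieldExtType 'F_2) : 2%N \in [pchar L].
Proof. by rewrite pchar_lalg pchar_Fp. Qed.

(** Squaring is additive in characteristic 2 and fixes the coefficients, which lie in F_2. *)
Lemma spectrum_sqr (L : fieldExtType 'F_2) s N (y : L) :
  spectrum s N (y ^+ 2) = spectrum s N y ^+ 2.
Proof.
rewrite -[RHS](pFrobenius_autE (pchar_F2ext L)) rmorph_sum.
apply: eq_bigr => u _.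
rewrite -[RHS]/(((s u)%:A * y ^+ u) ^+ 2) [LHS]/= [RHS]exprMn [in LHS]exprAC.
congr (_ * _); rewrite -[RHS](rmorphXn (in_alg L)) /=; congr (_ *: _).
by have := expf_card (s u); rewrite card_Fp.
Qed.

Lemma spectrum_exp2 (L : fieldExtType 'F_2) s N (y : L) k :
  spectrum s N (y ^+ (2 ^ k)) = spectrum s N y ^+ (2 ^ k).
Proof.
by elim: k => [|k IHk]; rewrite ?expr1 // expnSr !exprM spectrum_sqr IHk.
Qed.

(** Shifting [s] by i multiplies its transform at [y] by y^-i, because y^N = 1. Transforming the
    recurrence and cancelling the nonzero factor T(y) leaves the equation of the root. *)
Lemma recurrence_root (L : fieldExtType 'F_2) (s : nat -> 'F_2) N M
    (c : nat -> 'F_2) (y : L) :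
  (forall u, s (u + N)%N = s u) ->
  (forall u, s (u + M)%N = \sum_(i < M) c i * s (u + i)%N) -> y ^+ N = 1 ->
  y != 0 -> spectrum s N y != 0 ->
  root ('X^M - \poly_(i < M) (c i)%:A) y^-1.
Proof.
move=> sN rec yN y0 Ty0; have shift i : \sum_(u < N) (s (u + i)%N)%:A * y ^+ u
    = y ^- i * spectrum s N y.
  rewrite /spectrum -(sum_shift_period i (g := fun u => (s u)%:A * y ^+ u)).
    rewrite mulr_sumr; apply: eq_bigr => u _.
    by rewrite mulrCA exprD [y ^+ u * _]mulrC mulKf // expf_neq0.
  by move=> u; rewrite sN exprD yN mulr1.
rewrite /root !hornerE horner_poly exprVn subr_eq0; apply/eqP.
apply: (mulIf Ty0); rewrite -shift mulr_suml.
under eq_bigr => u _ do rewrite rec scaler_suml mulr_suml.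
rewrite exchange_big /=; apply: eq_bigr => i _.
rewrite exprVn -[RHS]mulrA -shift mulr_sumr; apply: eq_bigr => u _.
by rewrite mulrA; congr (_ * _); exact: (rmorphM (in_alg L)).
Qed.

Lemma recurrence_order_ge (L : fieldExtType 'F_2) (s : nat -> 'F_2) N (z : L)
    M :
  (forall u, s (u + N)%N = s u) ->
  N.-primitive_root z -> satisfies_recurrence s M ->
  (#|[pred i : 'I_N | spectrum s N (z ^+ i) != 0%R]| <= M)%N.
Proof.
move=> sN zP [c [_ rec]].
have z0 : z != 0.
  apply/eqP=> z_eq0; have := prim_expr_order zP; rewrite z_eq0 expr0n.
  by rewrite gtn_eqF ?(prim_order_gt0 zP) // => /eqP; rewrite eq_sym oner_eq0.
have sC : size ('X^M - \poly_(i < M) (c i)%:A : {poly L}) = M.+1.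
  by rewrite size_polyDl size_polyXn // size_polyN ltnS size_poly.
rewrite -ltnS -{1}sC cardE -(size_map (fun i : 'I_N => (z ^+ i)^-1)).
apply: max_poly_roots; first by rewrite -size_poly_gt0 sC.
  apply/allP=> x /mapP[i]; rewrite mem_enum inE => Ti ->.
  apply: (recurrence_root sN rec) => //; last by rewrite expf_neq0.
  by rewrite exprAC (prim_expr_order zP) expr1n.
rewrite map_inj_uniq ?enum_uniq // => i j /invr_inj /eqP.
by rewrite (eq_prim_root_expr zP) !modn_small // => /eqP/val_inj.
Qed.

(** * Fermat quotients as elements of F_p *)

Definition fermat_quotient_Fp (p u : nat) : 'F_p :=
  (fermat_quotient p u%:Z)%:~R.

(** The witness [t] replaces the division by p. The equation forces [u] to be coprime to p, since
    otherwise p would divide 1. *)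
Lemma fermat_quotient_FpE p u t :
  prime p -> (u ^ p.-1 = 1 + t * p)%N -> fermat_quotient_Fp p u = t%:R.
Proof.
move=> p_prime ut; have p_gt0 := prime_gt0 p_prime.
have pu : coprime u p.
  rewrite coprime_sym prime_coprime //; apply/negP=> pu.
  have : (p %| u ^ p.-1)%N.
    by rewrite dvdn_exp // -subn1 subn_gt0 prime_gt1.
  by rewrite ut dvdn_addl ?dvdn_mull // dvdn1 gtn_eqF ?prime_gt1.
rewrite /fermat_quotient_Fp /fermat_quotient coprimezE /= pu.
have -> : u%:Z ^+ p.-1 - 1 = t%:Z * p%:Z.
  by rewrite -[u%:Z]natz -natrX ut natrD natrM !natz [1 + _]addrC addrK.
rewrite mulzK; last by rewrite eqz_nat -lt0n.
by rewrite modz_nat -pmulrn Fp_nat_mod.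
Qed.

(** Binomial expansion to first order in [p], with [X] absorbing the rest. *)
Lemma expn_addp p u k n :
  exists X,
    ((u + k * p) ^ n.+1 = u ^ n.+1 + n.+1 * k * p * u ^ n + p ^ 2 * X)%N.
Proof.
elim: n => [|n [X IHn]].
  by exists 0%N; rewrite !expn1 expn0 mul1n !muln1 muln0 addn0.
exists (n.+1 * k * k * u ^ n + X * (u + k * p))%N.
rewrite expnS IHn !expnS -[n.+2]add1n; ring.
Qed.

Lemma fermat_quotient_Fp_dvd p u :
  prime p -> (p %| u)%N -> fermat_quotient_Fp p u = 0.
Proof.
move=> p_prime pu; rewrite /fermat_quotient_Fp /fermat_quotient coprimezE /=.
by rewrite coprime_sym prime_coprime // pu.
Qed.

(** The first-order term of (u + k p)^(p - 1) is (p - 1) k p u^(p - 2). Dividing by p and using p -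
    1 = -1 in F_p gives the correction; u^(p - 2) stands for 1/u. *)
Lemma fermat_quotient_Fp_shift p u k : prime p -> ~~ (p %| u)%N ->
  fermat_quotient_Fp p (u + k * p) =
    fermat_quotient_Fp p u - k%:R * (u ^ p.-2)%:R.
Proof.
case: p => [|[|n]] // p_prime pu /=.
have u_gt0 e : (0 < u ^ e)%N by rewrite expn_gt0; case: (u) pu.
have [X eX] := expn_addp n.+2 u k n.
have /dvdnP[t tE] : (n.+2 %| u ^ n.+1 - 1)%N.
  rewrite -eqn_mod_dvd // -[X in (u ^ X)%N](totient_prime p_prime : _ = n.+1).
  by apply/eqP/Euler_exp_totient; rewrite coprime_sym prime_coprime.
have ut : (u ^ n.+1 = 1 + t * n.+2)%N by rewrite -tE subnKC.
rewrite (fermat_quotient_FpE p_prime ut).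
rewrite (@fermat_quotient_FpE _ _ (t + n.+1 * k * u ^ n + n.+2 * X)) //.
  have p0 : n.+2%:R = 0 :> 'F_n.+2 by apply: pchar_Fp_0.
  have p1 : n.+1%:R = -1 :> 'F_n.+2.
    by apply/eqP; rewrite -subr_eq0 opprK natr1 p0.
  rewrite natrD [(n.+2 * X)%:R]natrM p0 mul0r addr0.
  by rewrite natrD [(_ * _ * _)%:R]natrM [(_ * k)%:R]natrM p1 mulN1r mulNr.
by rewrite eX ut; ring.
Qed.

(** * The sequence as a nonsquare indicator *)

Definition nonsquare (F : finFieldType) (x : F) :=
  ~~ [exists y : F, y ^+ 2 == x].

(** Squaring is two-to-one on the nonzero elements, so half of these are squares; the extra 1 counts
    the square 0. *)
Lemma card_nonsquare (F : finFieldType) : 2%:R != 0 :> F ->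
  (#|@nonsquare F|.*2.+1 = #|F|)%N.
Proof.
move=> F2; pose A := [set x ^+ 2 | x in [pred x : F | x != 0]].
have cardA : (#|A|.*2 = #|F|.-1)%N.
  have <- : #|[pred x : F | x != 0]| = #|F|.-1.
    by rewrite -(cardC1 (0 : F)); apply: eq_card.
  rewrite -[RHS]sum1_card (partition_big (fun x => x ^+ 2) [in A]); last first.
    by move=> x x0; apply/imsetP; exists x.
  rewrite -muln2 -sum_nat_const; apply: eq_bigr => _ /imsetP[x + ->].
  rewrite inE => x0; rewrite (eq_bigl (mem [set x; - x])); last first.
    move=> y; rewrite !inE eqf_sqr andbC; case: (eqVneq y x) => [->|_] /=.
      by rewrite x0.
    by case: (eqVneq y (- x)) => //= ->; rewrite oppr_eq0 x0.
  rewrite sum1_card cards2; case: eqP => // /eqP.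
  by rewrite -addr_eq0 -mulr2n -mulr_natl mulf_eq0 (negPf F2) (negPf x0).
have /eq_card -> : @nonsquare F =i ~: (0 |: A).
  move=> x; rewrite !inE [LHS]/(nonsquare x) /nonsquare; congr (~~ _).
  apply/existsP/orP=> [[y /eqP<-]|].
    have [->|y0] := eqVneq y 0; first by left; rewrite expr0n.
    by right; apply: (imset_f (fun x => x ^+ 2)).
  case=> [/eqP->|/imsetP[y _ ->]]; last by exists y.
  by exists 0; rewrite expr0n.
have A0 : 0 \notin A.
  by apply/imsetP=> -[x x0 /esym/eqP]; rewrite expf_eq0 /= => /idPn; apply.
have := cardsC (0 |: A); rewrite cardsU1 A0 /= => cardAC.
have F_gt0 : (0 < #|F|)%N by apply/card_gt0P; exists 0.
by move: cardA cardAC F_gt0; move: #|F| #|A| #|~: _| => f a b; lia.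
Qed.

(** Since 0 is a square, the two cases in which the sequence vanishes merge into one. *)
Lemma fermat_quotient_seqE p u : prime p ->
  fermat_quotient_seq p u = (nonsquare (fermat_quotient_Fp p u))%:R.
Proof.
move=> p_prime; rewrite /fermat_quotient_seq /legendre.
rewrite -/(fermat_quotient_Fp p u); set q := fermat_quotient p u.
(* The integer quotient lies between 0 and p - 1, so it is 0 once its class is. *)
have q0 : fermat_quotient_Fp p u = 0 -> q == 0.
  rewrite /fermat_quotient_Fp -/q /q /fermat_quotient.
  case: ifP => // _; set t := (_ %/ _)%Z.
  have p_gt0 : 0 < p%:Z by rewrite ltz_nat prime_gt0.
  have := ltz_pmod t p_gt0; have := modz_ge0 t (lt0r_neq0 p_gt0).
  case: (t %% p)%Z => // r _; rewrite ltz_nat => r_lt /eqP.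
  rewrite -pmulrn -(dvdn_pcharf (pchar_Fp p_prime)).
  by case: r r_lt => // r r_lt; rewrite gtnNdvd.
rewrite /nonsquare; have [Q0|Q0] := eqVneq (fermat_quotient_Fp p u) 0.
  rewrite q0 // orbT; case: existsP => // -[]; exists 0.
  by rewrite Q0 expr0n.
have -> : (q == 0) = false.
  by apply: contraNF Q0 => /eqP; rewrite /fermat_quotient_Fp -/q => ->.
by case: [exists _, _].
Qed.

Lemma fermat_quotient_seq_dvd p u :
  prime p -> (p %| u)%N -> fermat_quotient_seq p u = 0.
Proof.
move=> p_prime pu; rewrite fermat_quotient_seqE // fermat_quotient_Fp_dvd //.
by rewrite /nonsquare; case: existsP => // -[]; exists 0; rewrite expr0n.
Qed.

Lemma fermat_quotient_seq_period p u : prime p ->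
  fermat_quotient_seq p (u + p ^ 2) = fermat_quotient_seq p u.
Proof.
move=> p_prime; have [pu|pu] := boolP (p %| u)%N.
  by rewrite !fermat_quotient_seq_dvd ?dvdn_addl ?dvdn_exp.
rewrite !fermat_quotient_seqE // -mulnn fermat_quotient_Fp_shift //.
by rewrite (pchar_Fp_0 p_prime) mul0r subr0.
Qed.

(** * Sums over a residue class modulo p *)

Lemma sum_ord_Fp (V : nmodType) p (F : nat -> V) : prime p ->
  \sum_(k < p) F k = \sum_(x : 'F_p) F x.
Proof.
by move=> pp; rewrite -(big_mkord xpredT) -{1}(Fp_cast pp) big_mkord.
Qed.

Lemma sum_ord_mul (V : nmodType) m p (F : nat -> V) :
  \sum_(u < m * p) F u = \sum_(v < p) \sum_(k < m) F (v + k * p)%N.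
Proof.
elim: m => [|m IHm].
  by rewrite big_ord0 big1 // => v _; rewrite big_ord0.
under [RHS]eq_bigr => v _ do rewrite big_ord_recr.
rewrite big_split -IHm mulSn addnC big_split_ord /=; congr (_ + _).
by apply: eq_bigr => v _; rewrite addnC.
Qed.

Lemma natr_Fp p (x : 'F_p) : (x : nat)%:R = x.
Proof. exact: natr_Zp. Qed.

Lemma Fp_natr_eq0 p v : prime p -> (v%:R == 0 :> 'F_p) = (p %| v)%N.
Proof. by move=> pp; rewrite -(dvdn_pcharf (pchar_Fp pp)). Qed.

(* Reindexing by the quotient [l] of [v + k p]: it is [q v - k / v], so that
   [k = (q v - l) v]. *)
Lemma fermat_quotient_seq_block (V : nmodType) p v (G : 'F_2 -> nat -> V) :
  prime p -> ~~ (p %| v)%N ->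
  \sum_(k < p) G (fermat_quotient_seq p (v + k * p)) k =
  \sum_(l : 'F_p) G (nonsquare l)%:R
                    ((fermat_quotient_Fp p v - l) * v%:R : 'F_p).
Proof.
move=> pp pv; set Q := fermat_quotient_Fp p v.
rewrite (sum_ord_Fp (fun k => G (fermat_quotient_seq p (v + k * p)) k)) //.
have cv : v%:R * (v ^ p.-2)%:R = 1 :> 'F_p.
  rewrite -natrM -expnS.
  have -> : p.-2.+1 = totient p.
    by rewrite totient_prime //; case: (p) pp => [|[]].
  rewrite -Fp_nat_mod // Euler_exp_totient ?Fp_nat_mod //.
  by rewrite coprime_sym prime_coprime.
rewrite (reindex (fun l : 'F_p => (Q - l) * v%:R)); last first.
  exists (fun x => Q - x * (v ^ p.-2)%:R) => l _.
    by rewrite -mulrA cv mulr1 subKr.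
  by rewrite subKr mulrAC -mulrA cv mulr1.
apply: eq_bigr => l _; congr (G _ _).
rewrite fermat_quotient_seqE // fermat_quotient_Fp_shift // -/Q.
by rewrite natr_Fp -mulrA cv mulr1 subKr.
Qed.

Lemma fermat_quotient_seq_block_sum p v : prime p -> odd p -> ~~ (p %| v)%N ->
  \sum_(k < p) fermat_quotient_seq p (v + k * p) = p./2%:R.
Proof.
move=> pp p_odd pv; rewrite (fermat_quotient_seq_block (fun x _ => x)) //.
have F2 : 2%:R != 0 :> 'F_p.
  by rewrite Fp_natr_eq0 // dvdn_prime2 //; apply: contraTneq p_odd => ->.
have <- : #|@nonsquare 'F_p| = p./2.
  by have := card_nonsquare F2; rewrite card_Fp //; move: #|_| => n <-; lia.
rewrite -sum1_card natr_sum [RHS]big_mkcond; apply: eq_bigr => l _.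
by rewrite -[l \in _]/(nonsquare l); case: (nonsquare l).
Qed.

Lemma F2_odd_natr n : n%:R = (odd n)%:R :> 'F_2.
Proof.
rewrite -{1}(odd_double_half n) natrD -mul2n natrM.
by rewrite (pchar_Fp_0 (isT : prime 2)) mul0r addr0.
Qed.

Lemma oppr_F2 (x : 'F_2) : - x = x.
Proof. by apply: oppr_pchar2; apply: pchar_Fp. Qed.

Lemma odd_half_mod4 p : odd p -> odd p./2 = (p %% 4 == 3)%N.
Proof. lia. Qed.

(** * Recurrences of the stated orders *)

Lemma satisfies_recurrence_1mod4 p : prime p -> odd p -> (p %% 4 = 1)%N ->
  satisfies_recurrence (fermat_quotient_seq p) (p ^ 2 - p).
Proof.
(* The characteristic polynomial is 1 + X^p + ... + X^(p^2 - p): the p terms of a residue class sum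
   to 0, because (p - 1)/2 is even. *)
move=> pp p_odd p1; exists (fun i => (p %| i)%N%:R); split=> [|u].
  by rewrite dvdn0.
have p_gt0 := prime_gt0 pp.
have -> : (p ^ 2 - p = p.-1 * p)%N.
  by rewrite -mulnn -[in RHS]subn1 mulnBl mul1n.
rewrite (sum_ord_mul _ _
  (fun i => (p %| i)%N%:R * fermat_quotient_seq p (u + i))).
rewrite (bigD1 (Ordinal p_gt0)) //= [X in _ + X]big1 => [|v v0].
  rewrite addr0; under eq_bigr => k _ do rewrite dvdn_mull // mul1r add0n.
  have : \sum_(k < p.-1.+1) fermat_quotient_seq p (u + k * p) = 0.
    rewrite prednK //; have [pu|pu] := boolP (p %| u)%N.
      apply: big1 => k _.
      by rewrite fermat_quotient_seq_dvd ?dvdn_addl ?dvdn_mull.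
    by rewrite fermat_quotient_seq_block_sum // F2_odd_natr odd_half_mod4 // p1.
  by rewrite big_ord_recr /= => /eqP; rewrite addr_eq0 oppr_F2 => /eqP->.
apply: big1 => k _; rewrite dvdn_addl ?dvdn_mull // gtnNdvd ?mul0r //.
by rewrite lt0n.
Qed.

Lemma satisfies_recurrence_sub1 p : prime p -> odd p ->
  satisfies_recurrence (fermat_quotient_seq p) (p ^ 2 - 1).
Proof.
(* With all coefficients 1, the recurrence says that a period sums to 0. This holds because the p -
   1 nonzero classes, an even number, have equal sums and class 0 contributes nothing. *)
move=> pp p_odd; exists (fun=> 1); split=> // u.
have p_gt0 := prime_gt0 pp.
apply/eqP; rewrite -subr_eq0 oppr_F2 addrC.
under eq_bigr => i _ do rewrite mul1r addnC.
have sN i : fermat_quotient_seq p (i + p ^ 2) = fermat_quotient_seq p i.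
  exact: fermat_quotient_seq_period.
suff : \sum_(i < (p ^ 2 - 1).+1) fermat_quotient_seq p (i + u) = 0.
  by rewrite big_ord_recr /= [(_ - 1 + u)%N]addnC => ->.
rewrite subn1 prednK ?expn_gt0 ?p_gt0 // (sum_shift_period u sN).
rewrite -mulnn (sum_ord_mul _ _ (fermat_quotient_seq p))
  (bigD1 (Ordinal p_gt0)) //= big1 => [|k _]; last first.
  by rewrite fermat_quotient_seq_dvd // dvdn_mull.
rewrite (eq_bigr (fun=> p./2%:R)) => [|v v0]; last first.
  rewrite fermat_quotient_seq_block_sum // gtnNdvd // lt0n.
  exact: v0.
rewrite sumr_const (cardC1 (Ordinal p_gt0)) card_ord add0r.
rewrite -(mulr_natr p./2%:R) (F2_odd_natr p.-1).
by rewrite (_ : odd p.-1 = false) ?mulr0 //; lia.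
Qed.

(** * Nonvanishing of the spectrum at roots of unity *)

Lemma spectrum_block (L : fieldExtType 'F_2) (s : nat -> 'F_2) p (y : L) :
  spectrum s (p * p) y =
  \sum_(v < p) (\sum_(k < p) (s (v + k * p)%N)%:A * (y ^+ p) ^+ k) * y ^+ v.
Proof.
rewrite /spectrum (sum_ord_mul _ _ (fun u => (s u)%:A * y ^+ u)).
apply: eq_bigr => v _.
rewrite mulr_suml; apply: eq_bigr => k _.
by rewrite exprD mulrA -exprM [(p * k)%N]mulnC mulrAC.
Qed.

(** As y^p = 1, a class v <> 0 contributes (p - 1)/2 times y^v, where (p - 1)/2 is odd, and these
    y^v add up to -1. *)
Lemma spectrum_p_root (L : fieldExtType 'F_2) p (y : L) :
  prime p -> (p %% 4 = 3)%N -> y ^+ p = 1 -> y != 1 ->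
  spectrum (fermat_quotient_seq p) (p * p) y != 0.
Proof.
move=> pp p3 yp y1; have p_odd : odd p by lia.
have p_gt0 := prime_gt0 pp.
have geom : \sum_(v < p | v != Ordinal p_gt0) y ^+ v = -1.
  move/eqP: (subrX1 y p); rewrite yp subrr eq_sym mulf_eq0 subr_eq0 (negPf y1).
  by rewrite (bigD1 (Ordinal p_gt0)) //= expr0 addrC addr_eq0 => /eqP.
suff -> : spectrum (fermat_quotient_seq p) (p * p) y = -1.
  by rewrite oppr_eq0 oner_eq0.
rewrite spectrum_block yp (bigD1 (Ordinal p_gt0)) //=.
rewrite big1 ?mul0r ?add0r => [|k _]; last first.
  by rewrite fermat_quotient_seq_dvd // ?dvdn_mull // scale0r mul0r.
rewrite -geom; apply: eq_bigr => v v0; rewrite -[RHS]mul1r; congr (_ * _).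
under eq_bigr => k _ do rewrite expr1n mulr1.
rewrite -scaler_suml fermat_quotient_seq_block_sum //.
  by rewrite F2_odd_natr odd_half_mod4 // p3 scale1r.
by rewrite gtnNdvd // lt0n.
Qed.

(** Lets exponents of a [p]-th root of unity be computed in F_p. *)
Lemma expr_Fp (R : nzRingType) p (w : R) (x : 'F_p) n :
  prime p -> w ^+ p = 1 -> x = n%:R -> w ^+ x = w ^+ n.
Proof.
move=> pp wp ->; rewrite val_Fp_nat // {2}(divn_eq n p) exprD mulnC exprM wp.
by rewrite expr1n mul1r.
Qed.

Lemma block_neq0 (L : fieldExtType 'F_2) p (w : L) :
  prime p -> odd p -> p.-primitive_root w ->
  ~ forall v, (0 < v < p)%N ->
    \sum_(k < p) (fermat_quotient_seq p (v + k * p))%:A * w ^+ k = 0.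
Proof.
move=> pp p_odd wP block0; have wp := prim_expr_order wP.
have p_gt0 := prime_gt0 pp; have p_gt1 := prime_gt1 pp.
have ltp (x : 'F_p) : (x < p)%N by rewrite -{2}(Fp_cast pp) ltn_ord.
have w0 : w != 0.
  by apply: contra_eq_neq wp => ->; rewrite expr0n gtn_eqF // eq_sym oner_eq0.
pose P : {poly L} := \poly_(l < p) (nonsquare (l%:R : 'F_p))%:R.
(* In the class v = -x the exponent (Q - l) v equals -Q x + x l, so the block sum is w^(-Q x)
   P(w^x). *)
have P_root (x : 'F_p) : x != 0 -> root P (w ^+ x).
  move=> x0; have vE := natr_Fp (- x); set v := (- x : 'F_p) : nat in vE.
  have v_gt0 : (0 < v)%N.
    by rewrite lt0n; apply: contraNneq x0 => v0; rewrite -oppr_eq0 -vE v0.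
  have v_lt : (v < p)%N := ltp _.
  have := block0 v; rewrite v_gt0 v_lt => /(_ isT).
  rewrite (fermat_quotient_seq_block (fun a k => a%:A * w ^+ k)) //; last first.
    by rewrite gtnNdvd.
  rewrite vE; set Q := fermat_quotient_Fp p v => block_v.
  suff : w ^+ (- (Q * x) : 'F_p) * P.[w ^+ x] = 0.
    by move/eqP; rewrite mulf_eq0 expf_eq0 (negPf w0) andbF.
  rewrite horner_poly -[RHS]block_v mulr_sumr.
  rewrite (sum_ord_Fp (fun l => w ^+ (- (Q * x) : 'F_p) *
    ((nonsquare (l%:R : 'F_p))%:R * (w ^+ x) ^+ l))) //.
  apply: eq_bigr => l _; rewrite natr_Fp.
  rewrite [in RHS](expr_Fp (n := (- (Q * x) : 'F_p) + x * l) pp wp); last first.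
    by rewrite natrD natrM !natr_Fp mulrBl mulrN mulrN opprK [l * x]mulrC.
  rewrite exprD exprM mulrCA; congr (_ * _).
  by case: nonsquare; rewrite ?scale1r ?scale0r.
have P0 : P = 0.
  have := size_poly p (fun l => (nonsquare (l%:R : 'F_p))%:R : L).
  apply: contraTeq => P0; rewrite -ltnNge.
  (* The root 0, present because 0 is a square, completes the p - 1 roots w^x with x <> 0 to p
     roots. *)
  pose rs := 0 :: [seq w ^+ nat_of_ord x | x in predC1 (0 : 'F_p)].
  suff : (size rs < size P)%N.
    by rewrite /= size_image (cardC1 (0 : 'F_p)) card_Fp // prednK.
  apply: max_poly_roots => //=.
    apply/andP; split.
      rewrite /root horner_coef0 coef_poly p_gt0 /nonsquare.
      by case: existsP => // -[]; exists 0; rewrite expr0n.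
    by apply/allP=> y /mapP[x]; rewrite mem_enum inE => x0 ->; apply: P_root.
  apply/andP; split.
    by apply/mapP=> -[x _ /esym/eqP]; rewrite expf_eq0 (negPf w0) andbF.
  rewrite map_inj_uniq ?enum_uniq // => x y /eqP.
  by rewrite (eq_prim_root_expr wP) !modn_small // => /eqP/val_inj.
have /card_gt0P[x xN] : (0 < #|@nonsquare 'F_p|)%N.
  have F2 : 2%:R != 0 :> 'F_p.
    by rewrite Fp_natr_eq0 // dvdn_prime2 //; apply: contraTneq p_odd => ->.
  have := card_nonsquare F2; rewrite card_Fp //.
  by case: #|_| => // p1; rewrite -p1 in p_gt1.
have /eqP := congr1 (fun q : {poly L} => q`_x) P0.
rewrite coef_poly ltp coef0 natr_Fp.
by rewrite (_ : nonsquare x) ?oner_eq0.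
Qed.

Lemma spectrum_primitive_root (L : fieldExtType 'F_2) p (y : L) :
  prime p -> odd p -> 2 ^ p.-1 <> 1 %[mod p ^ 2] ->
  (p ^ 2)%N.-primitive_root y ->
  spectrum (fermat_quotient_seq p) (p ^ 2) y != 0.
Proof.
move=> pp p_odd h yP; apply/eqP=> Ty0; have p_gt0 := prime_gt0 pp.
have yp2 := prim_expr_order yP.
have wP : p.-primitive_root (y ^+ p).
  have := dvdn_prim_root yP (dvdn_exp2l p (isT : 1 <= 2)%N).
  by rewrite expn1 mulnK.
have wp := prim_expr_order wP.
(* [q] is the Fermat quotient of 2 before reduction; by [h], p does not divide it. *)
have [q qE] : exists q, (2 ^ p.-1 = 1 + q * p)%N.
  have /dvdnP[q qE] : (p %| 2 ^ p.-1 - 1)%N.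
    rewrite -eqn_mod_dvd ?expn_gt0 // -totient_prime //.
    by apply/eqP/Euler_exp_totient; rewrite coprime2n.
  by exists q; rewrite -qE subnKC // expn_gt0.
have pq : ~~ (p %| q)%N.
  apply/negP=> /dvdnP[r rE]; apply: h.
  by rewrite qE rE -mulnA mulnn addnC modnMDl.
pose a v := \sum_(k < p) (fermat_quotient_seq p (v + k * p))%:A * (y ^+ p) ^+ k.
(* Raising to the power 1 + q p multiplies y by w^q and fixes every power of w, where w = y^p. *)
have expE k : y ^+ (2 ^ (p.-1 * k)) = y * (y ^+ p) ^+ (q * k).
  elim: k => [|k IHk]; first by rewrite !muln0 expr0 mulr1 expr1.
  rewrite mulnS addnC expnD exprM IHk qE; set W := _ ^+ (q * k).
  have Wp : W ^+ p = 1 by rewrite exprAC wp expr1n.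
  rewrite exprD expr1 [(q * p)%N]mulnC [_ ^+ (p * q)]exprM exprMn Wp mulr1.
  by rewrite -mulrA -exprD mulnSr.
(* The points y w^(q k) have the same p-th power w, so the coefficients [a v] do not depend on k. *)
have root_a k : \sum_(v < p) a v * y ^+ v * ((y ^+ p) ^+ q ^+ k) ^+ v = 0.
  have T0 :
      spectrum (fermat_quotient_seq p) (p * p) (y ^+ (2 ^ (p.-1 * k))) = 0.
    by rewrite mulnn spectrum_exp2 Ty0 expr0n expn_eq0.
  rewrite -[RHS]T0 expE spectrum_block exprMn [_ ^+ (q * k) ^+ p]exprAC wp.
  rewrite expr1n mulr1.
  by apply: eq_bigr => v _; rewrite exprMn mulrA -[_ ^+ q ^+ k]exprM.
pose A : {poly L} := \poly_(v < p) (a v * y ^+ v).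
have A0 : A = 0.
  apply: contraTeq (size_poly p (fun v => a v * y ^+ v)) => A0.
  rewrite -ltnNge; pose rs := [seq (y ^+ p) ^+ q ^+ k | k : 'I_p].
  suff : (size rs < size A)%N by rewrite size_map size_enum_ord.
  have xP : p.-primitive_root ((y ^+ p) ^+ q).
    by rewrite prim_root_exp_coprime // coprime_sym prime_coprime.
  apply: max_poly_roots => //=.
    apply/allP=> x /mapP[k _ ->]; rewrite /root horner_poly.
    by rewrite root_a.
  rewrite map_inj_uniq ?enum_uniq // => i j /eqP.
  by rewrite (eq_prim_root_expr xP) !modn_small // => /eqP/val_inj.
apply: (block_neq0 pp p_odd wP) => v /andP[_ v_lt].
have /eqP := congr1 (fun q : {poly L} => q`_v) A0.
rewrite coef_poly v_lt coef0 mulf_eq0 expf_eq0 => /orP[/eqP //|].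
case/andP=> _ /eqP y_eq0; move/eqP: yp2; rewrite y_eq0 expr0n.
by rewrite gtn_eqF ?expn_gt0 ?p_gt0 // eq_sym oner_eq0.
Qed.

(** * Lower bounds and conclusion *)

Lemma linear_complexity_lower_bound p M (A : pred 'I_(p ^ 2)) :
  prime p -> odd p -> satisfies_recurrence (fermat_quotient_seq p) M ->
  (forall (L : fieldExtType 'F_2) (z : L) i, (p ^ 2)%N.-primitive_root z ->
     A i -> spectrum (fermat_quotient_seq p) (p ^ 2) (z ^+ i) != 0) ->
  (#|A| <= M)%N.
Proof.
move=> pp p_odd rec TA.
have p2_neq0 : (p ^ 2)%:R != 0 :> 'F_2 by rewrite F2_odd_natr oddX p_odd.
have p2_gt0 : (0 < p ^ 2)%N by rewrite expn_gt0 prime_gt0.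
have [L [z zP]] := exists_primitive_root p2_gt0 p2_neq0.
have sN u := fermat_quotient_seq_period u pp.
apply: leq_trans (recurrence_order_ge sN zP rec).
by apply/subset_leq_card/subsetP=> i Ai; rewrite inE TA.
Qed.

Theorem theorem4 (p : nat) (p_prime : prime p) (p_odd : odd p)
    (h : 2 ^ p.-1 <> 1 %[mod p ^ 2]) :
  (p = 1 %[mod 4] ->
     is_linear_complexity (fermat_quotient_seq p) (p ^ 2 - p)) /\
  (p = 3 %[mod 4] ->
     is_linear_complexity (fermat_quotient_seq p) (p ^ 2 - 1)).
Proof.
have p_gt0 := prime_gt0 p_prime.
have coprimeT (L : fieldExtType 'F_2) (z : L) i : (p ^ 2)%N.-primitive_root z ->
    coprime (p ^ 2) i -> spectrum (fermat_quotient_seq p) (p ^ 2) (z ^+ i) != 0.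
  move=> zP ci; apply: spectrum_primitive_root => //.
  by rewrite prim_root_exp_coprime // coprime_sym.
split=> p4; split.
- exact: satisfies_recurrence_1mod4.
- move=> M rec.
  (* Exponents coprime to p^2 keep [z ^+ i] primitive; there are totient(p^2) = p^2 - p of them. *)
  have <- : #|[pred i : 'I_(p ^ 2) | coprime (p ^ 2) i]| = (p ^ 2 - p)%N.
    rewrite -sum1_card -(big_mkord (coprime (p ^ 2)) (fun=> 1%N)) /= big_mkcond.
    rewrite -[LHS](totient_count_coprime (p ^ 2)) totient_pfactor // expn1.
    by rewrite -subn1 mulnBl mul1n mulnn.
  by apply: linear_complexity_lower_bound rec _ => // L z i zP; apply: coprimeT.
- exact: satisfies_recurrence_sub1.
- move=> M rec; have p2_gt0 : (0 < p ^ 2)%N by rewrite expn_gt0 p_gt0.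
  (* Now every exponent i <> 0 counts: if p divides i, then z^i is a p-th root of unity other than
     1. *)
  have <- : #|predC1 (Ordinal p2_gt0)| = (p ^ 2 - 1)%N.
    by rewrite cardC1 card_ord subn1.
  apply: linear_complexity_lower_bound rec _ => // L z i zP i0.
  have [ci|pi] := boolP (coprime (p ^ 2) i); first exact: coprimeT.
  suff : spectrum (fermat_quotient_seq p) (p * p) (z ^+ i) != 0.
    by rewrite mulnn.
  apply: spectrum_p_root => //.
    have /dvdnP[j ->] : (p %| i)%N.
      by move: pi; rewrite coprime_pexpl // prime_coprime // negbK.
    by rewrite -exprM -mulnA mulnn mulnC exprM (prim_expr_order zP) expr1n.
  apply: contraNneq i0 => zi; apply/eqP/val_inj => /=.
  have := eq_prim_root_expr zP i 0; rewrite expr0 zi eqxx mod0n modn_small //.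
  by move=> /esym/eqP.
Qed.
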